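(* Let $a,b$ be real constants with $0\le b\le a$, and consider the vertex-random graph $G=\mathrm{VRG}\big(n,[\tfrac{b\log n}{n},\tfrac{a\log n}{n}]\big)$. If $a>1$ and $a-b>0.5$, then $G$ is connected with probability $1-o(1)$ as $n\to\infty$. If $a<1$ or $a-b<0.5$, then $G$ is not connected with probability $1-o(1)$.
   Context: For $0\le r_1\le r_2\le 1/2$, the vertex-random graph $\mathrm{VRG}(n,[r_1,r_2])$ has vertex set $\{1,\dots,n\}$; each vertex $i$ receives an independent uniform random number $X_i\in[0,1]$, and distinct vertices $i,j$ are adjacent if and only if $r_1\le d_L(X_i,X_j)\le r_2$, where $d_L(x,y)=\min\{|x-y|,1-|x-y|\}$. Here $\log$ is the natural logarithm. *)

(* Defs.v *)
From HB Require Import structures.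
From mathcomp Require Import all_boot all_order all_algebra.
From mathcomp Require Import all_classical all_reals all_analysis.

Set Implicit Arguments.
Unset Strict Implicit.
Unset Printing Implicit Defensive.

Import Order.TTheory GRing.Theory Num.Theory.
Import numFieldNormedType.Exports.

Local Open Scope classical_set_scope.
Local Open Scope ring_scope.

Definition dL (R : realType) (x y : R) : R :=
  Num.min `|x - y| (1 - `|x - y|).

(* Adjacency relation of the graph on 'I_n determined by the vertex labels x;
   vertex k of {1, ..., n} is the ordinal k - 1. *)
Definition VRG (R : realType) (n : nat) (r1 r2 : R) (x : 'I_n -> R) :
    rel 'I_n :=
  fun i j => (i != j) && (r1 <= dL (x i) (x j) <= r2).

Lemma VRG_irrefl (R : realType) (n : nat) (r1 r2 : R) (x : 'I_n -> R) :
  irreflexive (VRG r1 r2 x).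
Proof. by move=> i; rewrite /VRG eqxx. Qed.

Lemma VRG_sym (R : realType) (n : nat) (r1 r2 : R) (x : 'I_n -> R) :
  symmetric (VRG r1 r2 x).
Proof. by move=> i j; rewrite /VRG /dL eq_sym distrC. Qed.

Definition graph_connected (V : finType) (e : rel V) : Prop :=
  forall u v : V, connect e u v.

Definition mutually_independent (d : measure_display) (T : measurableType d)
    (R : realType) (P : probability T R) (I : finType)
    (X : I -> {RV P >-> R}) : Prop :=
  forall (J : {set I}) (B : I -> set R), (forall i, measurable (B i)) ->
    P (\bigcap_(i in [set` J]) (X i @^-1` B i)) =
    (\prod_(i in J) P (X i @^-1` B i))%E.

(* Restricted to measurable sets because measures are total functions on
   'set R', with unspecified values elsewhere. *)
Definition uniform01 (d : measure_display) (T : measurableType d)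
    (R : realType) (P : probability T R) (X : {RV P >-> R}) : Prop :=
  forall B : set R, measurable B ->
    distribution P X B = uniform_prob (@ltr01 R) B.

(* Main.v *)
(* Cut the circle into M ~ m n / log n cells, m a large constant, and retain
   only the cell of each X_i. A cell has length about (log n) / (m n), so k given
   cells are all empty with probability (1 - k / M)^n ~ n^(-k / m).

   Connectivity. By a union bound, with high probability every window of a fixed
   number of consecutive cells contains fewer than m empty ones. Unroll the
   circle to a line and forget everything else. By pigeonhole, fully occupied
   stretches recur at bounded distance, and the points of such a stretch are
   connected to each other. Take two of them, W on the left and W' on the right.
   If each point between can step to the left, all of them reach W. Otherwise
   some point cannot, and the cells it would step to lie in a maximal empty run
   H; as a - b > 1/2, two disjoint runs of this kind would contain m empty cells,
   so every point left of H can step to the left and every point right of H can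
   step to the right. Some edge jumps over H: as a > 1, the two points bordering H
   are at distance at most a log n / n, and if they are too close to be
   adjacent, then the left one has a neighbour beyond H by the same count.

   Disconnection. A pattern of one occupied cell followed by (or centered in) u
   empty cells with u < m occurs at least twice among disjoint translates, by the
   second moment method: its mean number is about n^(1 - u / m) / log n. If a < 1,
   two gaps longer than a log n / n separate the graph; if a - b < 1/2 and
   a >= 1, the pattern surrounds an isolated vertex. *)

Require Import Defs.
From HB Require Import structures.
From mathcomp Require Import all_boot all_order all_algebra.
From mathcomp Require Import all_classical all_reals all_analysis.
From mathcomp Require Import measurable_realfun ring lra zify.

Import Order.TTheory GRing.Theory Num.Theory.
Import numFieldNormedType.Exports.

Local Open Scope ring_scope.

(** * Connectivity on the integer line *)

Section Line.
(** In the application [V] consists of the lifts of the vertices to the line, [c] gives the cell and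
    [r] says that a path joins the two vertices. [m_al] reflects [a > 1], and [m_width] reflects
    [a - b > 1/2]. *)
Variables (V : Type) (c : V -> int) (r : V -> V -> Prop).
Variables (be al m : nat).
Hypothesis rsym : forall x y, r x y -> r y x.
Hypothesis rtrans : forall x y z, r x y -> r y z -> r x z.
Hypothesis adj : forall x y, be%:Z <= c y - c x <= al%:Z -> r x y.
Hypothesis be_gt0 : (0 < be)%N.
Hypothesis be_lt_al : (be.+1 <= al)%N.
Hypothesis m_gt0 : (0 < m)%N.
Hypothesis m_al : (m <= al)%N.
Hypothesis m_width : (m <= 2 * (al.+1 - be))%N.

Definition occ (j : int) : bool := `[< exists x, c x = j >].

(** Finite sets of cells are duplicate-free sequences, since [int] is not a finite type. *)
Definition few_empty (s t : int) := forall A : seq int, uniq A ->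
  (forall j : int, j \in A -> s <= j < t /\ ~~ occ j) -> (size A < m)%N.

Lemma occP j : reflect (exists x, c x = j) (occ j).
Proof. exact: asboolP. Qed.

Lemma not_occ (A : pred int) : ~ (exists2 j, A j & occ j) ->
  forall j, A j -> ~~ occ j.
Proof. by move=> no j Aj; apply/negP => oj; apply: no; exists j. Qed.

Lemma few_emptyW s t s' t' : s <= s' -> t' <= t -> few_empty s t ->
  few_empty s' t'.
Proof.
move=> ss tt H A uA HA; apply: (H A uA) => j /HA [/andP[h1 h2] h3]; split=> //.
by apply/andP; split; lia.
Qed.

Definition irange (s : int) (k : nat) : seq int := [seq s + i%:Z | i <- iota 0 k].

Lemma size_irange s k : size (irange s k) = k.
Proof. by rewrite size_map size_iota. Qed.

Lemma mem_irange s k j : (j \in irange s k) = (s <= j < s + k%:Z).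
Proof.
apply/mapP/idP => [[i]|].
  by rewrite mem_iota => ? ->; lia.
by move=> ?; exists (absz (j - s)%R); [rewrite mem_iota; lia|lia].
Qed.

Lemma irange_uniq s k : uniq (irange s k).
Proof. by rewrite map_inj_uniq ?iota_uniq // => i j; lia. Qed.

(** Otherwise both runs, being disjoint, would supply [k1 + k2 >= m] distinct empty cells. *)
Lemma two_holes s t s1 k1 s2 k2 : few_empty s t ->
  s <= s1 -> s1 + k1%:Z <= s2 -> s2 + k2%:Z <= t -> (m <= k1 + k2)%N ->
  (forall j : int, s1 <= j < s1 + k1%:Z -> ~~ occ j) ->
  exists2 j, s2 <= j < s2 + k2%:Z & occ j.
Proof.
move=> H h1 h2 h3 h4 e1; apply: contrapT => /not_occ e2.
suff: (size (irange s1 k1 ++ irange s2 k2) < m)%N.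
  by rewrite size_cat !size_irange; lia.
apply: H.
  rewrite cat_uniq !irange_uniq andbT /=; apply/hasPn => j.
  by rewrite /= !mem_irange; lia.
move=> j; rewrite mem_cat !mem_irange => /orP[] hj.
  by split; [lia|exact: e1].
by split; [lia|exact: e2].
Qed.

Lemma one_hole s t s1 : few_empty s t -> s <= s1 -> s1 + m%:Z <= t ->
  exists2 j, s1 <= j < s1 + m%:Z & occ j.
Proof.
move=> H h1 h2; apply: (two_holes _ _ s1 0 s1 m H) => //; try lia.
Qed.

(** Pigeonhole: an empty cell chosen in each of the [m] blocks of length [D] would give [m] distinct
    empty cells. *)
Lemma dense_subwindow s (D : nat) : few_empty s (s + (m * D)%N%:Z) ->
  exists2 k : nat, (k < m)%N &
    forall j, s + (k * D)%N%:Z <= j < s + (k.+1 * D)%N%:Z -> occ j.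
Proof.
move=> H; apply: contrapT => no.
have {}E k : exists j, (k < m)%N ->
    s + (k * D)%N%:Z <= j < s + (k.+1 * D)%N%:Z /\ ~~ occ j.
  (* The value 0 beyond the last block is a dummy, as [choice] asks for a total function. *)
  case: (ltnP k m) => km; last by exists 0.
  have /existsNP[j /not_implyP[hj /negP nj]] : ~ forall j,
      s + (k * D)%N%:Z <= j < s + (k.+1 * D)%N%:Z -> occ j.
    by move=> full; apply: no; exists k.
  by exists j.
have [g hg] := choice E.
suff: (size [seq g k | k <- iota 0 m] < m)%N by rewrite size_map size_iota ltnn.
apply: H.
  rewrite map_inj_in_uniq ?iota_uniq // => i j; rewrite !mem_iota /= => hi hj e.
  have [gi _] := hg i hi; have [gj _] := hg j hj.
  rewrite e in gi.
  by apply/eqP; rewrite eqn_leq; apply/andP; split; apply/negP => /negP; nia.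
move=> j /mapP[k]; rewrite mem_iota /= => hk ->.
by have [gk nk] := hg k hk; split=> //; nia.
Qed.

(** The point [z] is a common neighbour: it is [be] or [be + 1] cells away from both, and
    [be + 1 <= al]. *)
Lemma near_related x y z : c x <= c y <= c x + 1 ->
  c z = c x + be%:Z + 1 \/ c z = c x - be%:Z -> r x y.
Proof.
move=> h [] e.
  by apply: (rtrans _ z); [|apply: rsym]; apply: adj; lia.
by apply: (rtrans _ z); [apply: rsym|]; apply: adj; lia.
Qed.

Lemma dense_related s : (forall j : int, s <= j < s + (2 * al)%N%:Z -> occ j) ->
  forall x y, s <= c x < s + (2 * al)%N%:Z -> s <= c y < s + (2 * al)%N%:Z ->
  r x y.
Proof.
move=> H.
have step x y : s <= c x < s + (2 * al)%N%:Z -> s <= c y < s + (2 * al)%N%:Z ->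
    c x <= c y <= c x + 1 -> r x y.
  move=> hx hy hxy.
  (* A stretch of [2 al] cells has room for the common neighbour on one of the two sides. *)
  case: (leP s (c x - be%:Z)) => h.
    have /occP[z hz] : occ (c x - be%:Z) by apply: H; lia.
    by apply: (near_related _ _ z) => //; right.
  have /occP[z hz] : occ (c x + be%:Z + 1) by apply: H; lia.
  by apply: (near_related _ _ z) => //; left.
have main (k : nat) : forall x y, s <= c x < s + (2 * al)%N%:Z ->
    s <= c y < s + (2 * al)%N%:Z -> c y = c x + k%:Z -> r x y.
  elim: k => [|k IH] x y hx hy e; first by apply: step => //; lia.
  have /occP[z hz] : occ (c x + k%:Z) by apply: H; lia.
  apply: (rtrans _ z); first by apply: IH => //; lia.
  by apply: step; lia.
move=> x y hx hy; case: (leP (c x) (c y)) => h.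
  by apply: (main (absz (c y - c x)%R)) => //; lia.
by apply: rsym; apply: (main (absz (c y - c x)%R)) => //; lia.
Qed.

(** Every point is carried to [w] in the left stretch or to [w'] in the right one. The only obstacle
    is a single wide hole, and a step over it links [w] to [w']. *)
Lemma segment_related (s t : int) x y :
  few_empty s (t + (2 * al)%N%:Z) -> s + (2 * al)%N%:Z <= t ->
  (forall j : int, s <= j < s + (2 * al)%N%:Z -> occ j) ->
  (forall j : int, t <= j < t + (2 * al)%N%:Z -> occ j) ->
  s <= c x < t + (2 * al)%N%:Z -> s <= c y < t + (2 * al)%N%:Z -> r x y.
Proof.
move=> few st W W' hx hy.
(* Descent on the distance to [s]: each step makes progress as [be > 0], and a step of at most [al]
   cells from beyond the left stretch cannot overshoot it. *)
have goleft (p : int) w : s <= c w < s + (2 * al)%N%:Z ->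
    (forall j : int, s + (2 * al)%N%:Z <= j < p -> occ j ->
       exists2 i : int, j - al%:Z <= i <= j - be%:Z & occ i) ->
    forall z, s <= c z < p -> p <= t + (2 * al)%N%:Z -> r w z.
  move=> hw move_left z.
  have [k] := ubnP (absz (c z - s)%R); elim: k z => // k IH z hk hz hp.
  case: (ltP (c z) (s + (2 * al)%N%:Z)) => h.
    by apply: (dense_related _ W); lia.
  have [|/=|i hi /occP[z' e]] := move_left (c z); [lia|by apply/occP; exists z|].
  by apply: (rtrans _ z'); [apply: IH; lia|apply: adj; lia].
have goright (q : int) w : t <= c w < t + (2 * al)%N%:Z ->
    (forall j : int, q <= j < t -> occ j ->
       exists2 i : int, j + be%:Z <= i <= j + al%:Z & occ i) ->
    forall z, q <= c z < t + (2 * al)%N%:Z -> s <= q -> r w z.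
  move=> hw move_right z.
  have [k] := ubnP (absz (t + (2 * al)%N%:Z - c z)%R); elim: k z => // k IH z hk hz hp.
  case: (leP t (c z)) => h.
    by apply: (dense_related _ W'); lia.
  have [|/=|i hi /occP[z' e]] := move_right (c z); [lia|by apply/occP; exists z|].
  by apply: (rtrans _ z'); [apply: IH; lia|apply: rsym; apply: adj; lia].
have /occP[w ew] : occ s by apply: W; lia.
have /occP[w' ew'] : occ t by apply: W'; lia.
have [noleft|] := pselect (forall j : int, s + (2 * al)%N%:Z <= j < t + (2 * al)%N%:Z ->
    occ j -> exists2 i : int, j - al%:Z <= i <= j - be%:Z & occ i).
  by apply: (rtrans _ w); [apply: rsym|]; apply: (goleft (t + (2 * al)%N%:Z)) => //; lia.
move=> /existsNP[v] /not_implyP[hv] /not_implyP[ov] /not_occ nov.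
(* The cells from [v - al] to [v - be] are empty; [p] and [q] will be the nearest occupied cells on
   either side of them. *)
have exp : exists k : nat, occ (v - al%:Z - k%:Z).
  by exists (absz (v - al%:Z - s)%R); apply: W; lia.
have exq : exists k : nat, occ (v - be%:Z + k%:Z).
  by exists be; rewrite subrK.
case: (ex_minnP exp) => kp; set p := v - al%:Z - kp%:Z => op minp.
case: (ex_minnP exq) => kq; set q := v - be%:Z + kq%:Z => oq minq.
have sp : s <= p.
  have := minp (absz (v - al%:Z - s)%R).
  have -> : v - al%:Z - (absz (v - al%:Z - s)%R)%:Z = s by lia.
  by move=> /(_ (W s _)); rewrite /p; lia.
have qv : q <= v by have := minq be; rewrite subrK => /(_ ov); rewrite /q; lia.
have hole j : p < j < q -> ~~ occ j.
  move=> hj; case: (ltP j (v - al%:Z)) => h1.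
    apply/negP => oj; have := minp (absz (v - al%:Z - j)%R).
    have -> : v - al%:Z - (absz (v - al%:Z - j)%R)%:Z = j by lia.
    by move=> /(_ oj); rewrite /p in hj; lia.
  case: (leP j (v - be%:Z)) => h2; first by apply: nov; lia.
  apply/negP => oj; have := minq (absz (j - (v - be%:Z))%R).
  have -> : v - be%:Z + (absz (j - (v - be%:Z))%R)%:Z = j by lia.
  by move=> /(_ oj); rewrite /q in hj; lia.
have wide : p + (al.+1 - be)%N%:Z + 1 <= q.
  have e1 : p != v - al%:Z by apply: contraTneq op => ->; apply: nov; lia.
  have e2 : q != v - be%:Z by apply: contraTneq oq => ->; apply: nov; lia.
  by rewrite /p /q in e1 e2 *; lia.
have pt : p < t.
  rewrite ltNge; apply/negP => tp.
  have : occ (p + 1) by apply: W'; lia.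
  by apply/negP; apply: hole; lia.
have left_ok z : s <= c z <= p -> r w z.
  move=> hz; apply: (goleft (p + 1)); try lia.
  move=> j hj _.
  (* In [two_holes] the run known to be empty is the left one. Hence this run is assumed empty,
     which forces an occupied cell inside the hole. *)
  have [i hi oi] : exists2 i : int, j - al%:Z <= i < j - al%:Z + (al.+1 - be)%N%:Z & occ i.
    apply: contrapT => /not_occ no.
    have [i hi oi] : exists2 i : int, p + 1 <= i < p + 1 + (al.+1 - be)%N%:Z & occ i.
      apply: (two_holes _ _ (j - al%:Z) (al.+1 - be) _ _ few); try lia.
      exact: no.
    by move: oi; apply/negP; apply: hole; lia.
  by exists i => //; lia.
have right_ok z : q <= c z < t + (2 * al)%N%:Z -> r w' z.
  move=> hz; apply: (goright q); try lia.
  move=> j hj _.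
  have [i hi oi] : exists2 i : int, j + be%:Z <= i < j + be%:Z + (al.+1 - be)%N%:Z & occ i.
    apply: (two_holes _ _ (p + 1) (al.+1 - be) _ _ few); try lia.
    by move=> i hi; apply: hole; lia.
  by exists i => //; lia.
have ww' : r w w'.
  have [xp exp'] := occP _ op; have [xq exq'] := occP _ oq.
  have qp : q <= p + m%:Z.
    rewrite leNgt; apply/negP => h.
    have [||i hi] := one_hole _ _ (p + 1) few; [lia|lia|].
    by apply/negP; apply: hole; lia.
  case: (leP (p + be%:Z) q) => h.
    apply: (rtrans _ xp); first by apply: left_ok; lia.
    apply: (rtrans _ xq); first by apply: adj; lia.
    by apply: rsym; apply: right_ok; lia.
  (* Here the cells from [p + be] to [p + al] lie beyond [q], so they are disjoint from the hole and
     cannot all be empty. *)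
  have [i hi oi] : exists2 i : int, p + be%:Z <= i < p + be%:Z + (al.+1 - be)%N%:Z & occ i.
    apply: (two_holes _ _ (p + 1) (al.+1 - be) _ _ few); try lia.
    by move=> i hi; apply: hole; lia.
  have [z ez] := occP _ oi.
  apply: (rtrans _ xp); first by apply: left_ok; lia.
  apply: (rtrans _ z); first by apply: adj; lia.
  by apply: rsym; apply: right_ok; lia.
have all_ok z : s <= c z < t + (2 * al)%N%:Z -> r w z.
  move=> hz; case: (leP (c z) p) => h1; first by apply: left_ok; lia.
  case: (leP q (c z)) => h2.
    by apply: (rtrans _ _ _ ww'); apply: right_ok; lia.
  have : ~~ occ (c z) by apply: hole; lia.
  by case/negP; apply/occP; exists z.
by apply: (rtrans _ w); [apply: rsym|]; apply: all_ok.
Qed.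

(* Such a window holds m cells, in which steps between neighbouring points are
   bridged, flanked by m blocks of 2 al cells on either side, one of which is
   fully occupied. *)
Lemma line_related :
  (forall s, few_empty s (s + (4 * (m * al) + m.+1)%N%:Z)) -> forall x y, r x y.
Proof.
move=> few.
have close x y : c x - m%:Z <= c y <= c x -> r x y.
  move=> h; pose s0 := c x - m%:Z - (m * (2 * al))%N%:Z.
  have f0 := few s0.
  have [|k hk W] := @dense_subwindow s0 (2 * al).
    by apply: few_emptyW f0 => //; lia.
  have [|k' hk' W'] := @dense_subwindow (c x + 1) (2 * al).
    by apply: few_emptyW f0; rewrite /s0; lia.
  apply: (@segment_related (s0 + (k * (2 * al))%N%:Z)
    (c x + 1 + (k' * (2 * al))%N%:Z)).
  - apply: few_emptyW f0; rewrite /s0; nia.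
  - by rewrite /s0; nia.
  - by move=> j hj; apply: W; lia.
  - by move=> j hj; apply: W'; lia.
  - by rewrite /s0; nia.
  - by rewrite /s0; nia.
have mono x y : c x <= c y -> r x y.
  have [k] := ubnP (absz (c y - c x)%R); elim: k y => // k IH y hk h.
  case: (leP (c y - m%:Z) (c x)) => h'.
    by apply: rsym; apply: close; lia.
  (* One of the [m] cells just before [c y] is occupied, and its point is still to the right of
     [x]. *)
  have [||i hi /occP[z e]] := one_hole _ _ (c y - m%:Z) (few (c y - m%:Z)); [lia|lia|].
  apply: (rtrans _ z); first by apply: IH; lia.
  by apply: rsym; apply: close; lia.
move=> x y; case: (leP (c x) (c y)) => h; first exact: mono.
by apply: rsym; apply: mono; lia.
Qed.
End Line.

Set Implicit Arguments.
Unset Strict Implicit.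
Unset Printing Implicit Defensive.

(** * Counting assignments of vertices to cells *)

Lemma card_bigcup_le (I T : finType) (P : pred I) (F : I -> {set T}) :
  (#|\bigcup_(i | P i) F i| <= \sum_(i | P i) #|F i|)%N.
Proof.
elim/big_rec2: _ => [|i k A _ le_kA]; first by rewrite cards0.
by apply: leq_trans (leq_card_setU _ _) _; rewrite leq_add2l.
Qed.

Definition avoiding (n M : nat) (S : {set 'I_M}) : {set {ffun 'I_n -> 'I_M}} :=
  [set f : {ffun 'I_n -> 'I_M} | [forall i, f i \notin S]].

Lemma card_avoiding (n M : nat) (S : {set 'I_M}) :
  #|avoiding n S| = ((M - #|S|) ^ n)%N.
Proof.
transitivity #|ffun_on (mem (~: S)) : pred {ffun 'I_n -> 'I_M}|.
  apply: eq_card => f; rewrite inE.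
  apply/forallP/ffun_onP => h i; first by rewrite inE; exact: h.
  by have := h i; rewrite inE.
rewrite card_ffun_on card_ord; congr (_ ^ _)%N; transitivity #|~: S|; first by apply: eq_card.
by rewrite cardsCs finset.setCK card_ord.
Qed.

Lemma avoidingS (n M : nat) (S S' : {set 'I_M}) : S \subset S' ->
  avoiding n S' \subset avoiding n S.
Proof.
move=> /fintype.subsetP sub; apply/fintype.subsetP => f; rewrite !inE => /forallP h.
by apply/forallP => i; apply: contra (h i); exact: sub.
Qed.

(** Cyclic counterpart of [few_empty]: every window of [N] consecutive cells, wrapped modulo [M],
    has fewer than [m] empty ones. *)
Definition hits_windows (n M N m : nat) (f : {ffun 'I_n -> 'I_M}) : bool :=
  [forall j : 'I_M, forall A : {set 'I_N}, (#|A| == m) ==>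
    [exists i, [exists a in A, (f i == (j + a) %% M :> nat)%N]]].

(** Union bound over the [M] starting cells and at most [2 ^ N] sets of offsets. Since [N <= M],
    wrapping keeps the [m] cells distinct. *)
Lemma card_not_hits_windows (n M N m : nat) : (N <= M)%N ->
  (#|[set f : {ffun 'I_n -> 'I_M} | ~~ hits_windows N m f]| <=
     M * 2 ^ N * (M - m) ^ n)%N.
Proof.
case: M => [|M] NM.
  (* Without cells there is no starting cell, so [hits_windows] holds vacuously. *)
  rewrite !mul0n leqn0 cards_eq0; apply/eqP/finset.setP => f; rewrite !inE.
  by apply/negbF/forallP => -[].
pose img (jA : 'I_M.+1 * {set 'I_N}) : {set 'I_M.+1} :=
  [set inord ((jA.1 + a) %% M.+1)%N | a : 'I_N in jA.2].
have inj (j : 'I_M.+1) :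
    injective (fun a : 'I_N => inord ((j + a) %% M.+1)%N : 'I_M.+1).
  move=> x y /(congr1 val); rewrite /= !inordK ?ltn_mod // => /eqP.
  rewrite eqn_modDl !modn_small; try by apply: leq_trans NM.
  by move/eqP/val_inj.
have sub : [set f : {ffun 'I_n -> 'I_M.+1} | ~~ hits_windows N m f] \subset
    \bigcup_(jA : 'I_M.+1 * {set 'I_N} | #|jA.2| == m) avoiding n (img jA).
  apply/fintype.subsetP => f; rewrite inE negb_forall => /existsP[j].
  rewrite negb_forall => /existsP[A]; rewrite negb_imply => /andP[cA nof].
  apply/finset.bigcupP; exists (j, A) => //; rewrite inE; apply/forallP => i.
  apply/imsetP => -[a aA e]; move/negP: nof; apply.
  by apply/existsP; exists i; apply/existsP; exists a;
    rewrite aA e /= inordK ?ltn_mod.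
apply: leq_trans (subset_leq_card sub) _.
apply: leq_trans (card_bigcup_le _ _) _.
under eq_bigr => jA /eqP c.
  rewrite card_avoiding card_imset ?c; last exact: inj.
  over.
rewrite sum_nat_const leq_mul2r; apply/orP; right.
apply: leq_trans (max_card _) _.
by rewrite card_prod card_ord -cardsT -powersetT card_powerset cardsT card_ord.
Qed.

(** * The second moment method, by counting *)

Section SecondMoment.
Variables (R : realFieldType) (F : finType) (K : nat) (E : 'I_K -> {set F}).
Variables (p q : R).
Hypothesis card_E : forall t, #|E t|%:R = p * #|F|%:R.
Hypothesis card_EE : forall s t, s != t -> #|E s :&: E t|%:R <= q ^+ 2 * #|F|%:R.

Let Z (f : F) : R := \sum_(t < K) (f \in E t)%:R.

Let sum_indicator (A : {set F}) : \sum_f (f \in A)%:R = #|A|%:R :> R.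
Proof.
rewrite -natr_sum -sum1_card [in RHS]big_mkcond /=; congr (_ *+ _).
Qed.

Lemma sum_count : \sum_f Z f = K%:R * p * #|F|%:R.
Proof.
rewrite /Z exchange_big /=; under eq_bigr do rewrite sum_indicator card_E.
by rewrite sumr_const card_ord -mulrA mulr_natl.
Qed.

Lemma sum_count_sqr :
  \sum_f Z f ^+ 2 <= (K%:R * p + K%:R ^+ 2 * q ^+ 2) * #|F|%:R.
Proof.
have -> : \sum_f Z f ^+ 2 = \sum_(s < K) \sum_(t < K) #|E s :&: E t|%:R.
  rewrite (eq_bigr (fun f => \sum_(s < K) \sum_(t < K) (f \in E s :&: E t)%:R)).
    rewrite exchange_big /=; apply: eq_bigr => s _.
    by rewrite exchange_big /=; apply: eq_bigr => t _; rewrite sum_indicator.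
  move=> f _; rewrite expr2 /Z mulr_suml; apply: eq_bigr => s _.
  by rewrite mulr_sumr; apply: eq_bigr => t _; rewrite inE -natrM mulnb.
(* The diagonal term gives [p]; the others, at most [K] in number, give at most [q ^+ 2] each. *)
have row (s : 'I_K) : \sum_(t < K) #|E s :&: E t|%:R <=
    (p + K%:R * q ^+ 2) * #|F|%:R.
  rewrite (bigD1 s) //= finset.setIid card_E mulrDl lerD2l.
  apply: le_trans (_ : \sum_(t < K | t != s) q ^+ 2 * #|F|%:R <= _).
    by apply: ler_sum => t ts; apply: card_EE; rewrite eq_sym.
  rewrite sumr_const -[leLHS]mulr_natl -mulrA ler_wpM2r //.
    by rewrite mulr_ge0 // sqr_ge0.
  by rewrite ler_nat -[leqRHS]card_ord max_card.
apply: le_trans (ler_sum _ (fun s _ => row s)) _.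
rewrite sumr_const card_ord -[leLHS]mulr_natl [leLHS]mulrA.
by apply: ler_wpM2r => //; rewrite mulrDr expr2 !mulrA.
Qed.

(** Chebyshev's inequality with mean [mu = K p]: as [mu >= 2], a count of at most 1 deviates from
    [mu] by at least [mu / 2], and the variance is at most [mu + K^2 q^2 - mu^2]. *)
Lemma second_moment : 0 < p -> 2 <= K%:R * p ->
  #|[set f : F | (#|[set t | f \in E t]| <= 1)%N]|%:R <=
    4 * ((K%:R * p)^-1 + (q / p) ^+ 2 - 1) * #|F|%:R.
Proof.
move=> p0 Kp2; set A := [set f | _]; set mu := K%:R * p in Kp2 *.
have mu0 : 0 < mu by lra.
have var : \sum_f (Z f - mu) ^+ 2 <=
    (mu + K%:R ^+ 2 * q ^+ 2 - mu ^+ 2) * #|F|%:R.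
  rewrite (eq_bigr (fun f => Z f ^+ 2 + (- (2 * mu) * Z f + mu ^+ 2))); last first.
    by move=> f _; ring.
  rewrite !big_split /= -mulr_sumr sum_count sumr_const -/mu -[_ *+ _]mulr_natl.
  by have := sum_count_sqr; rewrite -/mu; lra.
have lower : (mu / 2) ^+ 2 * #|A|%:R <= \sum_f (Z f - mu) ^+ 2.
  rewrite -sum_indicator mulr_sumr; apply: ler_sum => f _.
  case fA: (f \in A); last by rewrite mulr0 sqr_ge0.
  rewrite mulr1.
  have Z1 : Z f <= 1.
    move: fA; rewrite inE -(ler_nat R); apply: le_trans.
    rewrite /Z -natr_sum ler_nat -sum1_card [leqRHS]big_mkcond /=.
    by apply: leq_sum => t _; rewrite inE; case: (_ \in _).
  by rewrite -[leRHS]sqrrN ler_sqr ?nnegrE; lra.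
have -> : 4 * (mu^-1 + (q / p) ^+ 2 - 1) * #|F|%:R =
    (mu + K%:R ^+ 2 * q ^+ 2 - mu ^+ 2) * #|F|%:R / (mu / 2) ^+ 2.
  have K0 : K%:R != 0 :> R by apply: contraTneq mu0 => e; rewrite /mu e mul0r ltxx.
  have pn0 : p != 0 by lra.
  by rewrite /mu; field; rewrite ?K0 ?pn0.
rewrite ler_pdivlMr ?exprn_gt0 ?divr_gt0 // mulrC.
exact: le_trans lower var.
Qed.
End SecondMoment.

(** * Translates of a pattern in disjoint blocks of cells *)

Section Blocks.
Variables (M s K : nat) (KsM : (K * s <= M)%N).

Lemma block_cell_subproof (t : 'I_K) (k : 'I_s) : (t * s + k < M)%N.
Proof.
have ht := ltn_ord t; have hk := ltn_ord k.
apply: leq_trans KsM; apply: (@leq_trans (t.+1 * s)%N); last by rewrite leq_mul2r ht orbT.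
by rewrite mulSn addnC ltn_add2r.
Qed.

Definition block_cell t k : 'I_M := Ordinal (block_cell_subproof t k).

Lemma block_cell_inj t t' k k' : block_cell t k = block_cell t' k' ->
  t = t' /\ k = k'.
Proof.
move=> /(congr1 val) /= e; have hk := ltn_ord k; have hk' := ltn_ord k'.
have s0 : (0 < s)%N by lia.
by split; apply: val_inj => /=; [have := congr1 (divn^~ s) e|have := congr1 (modn^~ s) e];
  rewrite /= ?divnMDl ?modnMDl ?divn_small ?addn0 // !modn_small.
Qed.

Definition pattern (U : {set 'I_s}) (t : 'I_K) : {set 'I_M} :=
  [set block_cell t k | k in U].

Lemma card_pattern U t : #|pattern U t| = #|U|.
Proof. by rewrite card_imset // => k k' /block_cell_inj[]. Qed.

Lemma disjoint_patterns U t t' : t != t' -> [disjoint pattern U t & pattern U t'].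
Proof.
move=> tt'; apply/pred0P => x /=; apply/andP => -[/imsetP[k _ ->]].
by case/imsetP => k' _ /block_cell_inj[/eqP]; rewrite (negPf tt').
Qed.

(** In block [t] the cells of [U] are empty but [o] is not. Written as a difference of nested
    [avoiding] sets, its size is a difference of two powers. *)
Definition lone_in_pattern (n : nat) (o : 'I_s) (U : {set 'I_s}) (t : 'I_K) :
    {set {ffun 'I_n -> 'I_M}} :=
  avoiding n (pattern U t) :\: avoiding n (pattern (o |: U) t).

Lemma card_lone_in_pattern n (o : 'I_s) (U : {set 'I_s}) t : o \notin U ->
  #|lone_in_pattern n o U t| = ((M - #|U|) ^ n - (M - #|U|.+1) ^ n)%N.
Proof.
move=> oU; rewrite cardsD (finset.setIidPr _) ?avoidingS ?imsetS ?finset.subsetUr //.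
by rewrite !card_avoiding !card_pattern cardsU1 oU.
Qed.

(** Forgetting the cell [o], it remains to avoid two disjoint translates of [U]. *)
Lemma card_lone_in_pattern2 n (o : 'I_s) (U : {set 'I_s}) t t' : t != t' ->
  (#|lone_in_pattern n o U t :&: lone_in_pattern n o U t'| <=
    (M - 2 * #|U|) ^ n)%N.
Proof.
move=> tt'; have := card_avoiding n (pattern U t :|: pattern U t').
have /eqP -> : (#|pattern U t :|: pattern U t'| == #|pattern U t| + #|pattern U t'|)%N.
  by rewrite (leq_card_setU _ _).2 disjoint_patterns.
rewrite !card_pattern addnn -mul2n => <-.
apply: subset_leq_card; apply/fintype.subsetP => f; rewrite !inE.
case/andP => /andP[_ /forallP h] /andP[_ /forallP h'].
by apply/forallP => i; rewrite inE negb_or h h'.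
Qed.

Lemma lone_in_patternP n (o : 'I_s) (U : {set 'I_s}) t (f : {ffun 'I_n -> 'I_M}) :
  f \in lone_in_pattern n o U t ->
  (exists i, f i = (t * s + o)%N :> nat) /\
  (forall i (k : 'I_s), k \in U -> f i <> (t * s + k)%N :> nat).
Proof.
rewrite !inE negb_forall => /andP[/existsP[i]]; rewrite negbK => fi /forallP h.
have h' j (k : 'I_s) : k \in U -> f j <> (t * s + k)%N :> nat.
  move=> kU e; move/negP: (h j); apply; apply/imsetP; exists k => //.
  exact: val_inj.
split=> //; exists i; move: fi => /imsetP[k].
by rewrite !inE => /orP[/eqP -> ->|kU e] //; case: (h' i k kU); rewrite e.
Qed.
End Blocks.

(** Second moment with [q = (1 - v) ^+ n], where [v = #|U| / M]; pairs are controlled by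
    [1 - 2 v <= (1 - v)^2]. *)
Lemma few_lone_in_pattern (R : realFieldType) (n M s K : nat)
    (KsM : (K * s <= M)%N) (o : 'I_s) (U : {set 'I_s}) (p : R) :
  o \notin U -> (0 < M)%N -> (2 * #|U| <= M)%N -> (#|U| < M)%N ->
  p = (1 - #|U|%:R / M%:R) ^+ n - (1 - #|U|.+1%:R / M%:R) ^+ n ->
  0 < p -> 2 <= K%:R * p ->
  #|[set f | (#|[set t | f \in lone_in_pattern KsM n o U t]| <= 1)%N]|%:R <=
    4 * ((K%:R * p)^-1 + ((1 - #|U|%:R / M%:R) ^+ n / p) ^+ 2 - 1) *
    M%:R ^+ n.
Proof.
move=> oU M0 U2 U1 pE p0 Kp2.
have M0' : M%:R != 0 :> R by rewrite pnatr_eq0 -lt0n.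
have cF : #|{ffun 'I_n -> 'I_M}|%:R = M%:R ^+ n :> R.
  by rewrite card_ffun !card_ord natrX.
have frac k : (k <= M)%N -> (M - k)%N%:R ^+ n = (1 - k%:R / M%:R) ^+ n * M%:R ^+ n :> R.
  by move=> kM; rewrite -exprMn natrB //; congr (_ ^+ _); field.
rewrite -cF; apply: second_moment => // [t|t t' tt'].
  rewrite card_lone_in_pattern // cF natrB; last by case: (posnP n) => [->|n0] //; rewrite leq_exp2r //; lia.
  by rewrite !natrX !frac ?pE ?mulrBl //; lia.
apply: le_trans (_ : ((M - 2 * #|U|) ^ n)%N%:R <= _).
  by rewrite ler_nat card_lone_in_pattern2.
rewrite natrX cF frac // ler_wpM2r ?exprn_ge0 //.
have : 0 <= 1 - (2 * #|U|)%N%:R / M%:R :> R.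
  by rewrite subr_ge0 ler_pdivrMr ?ltr0n // mul1r ler_nat.
move=> h; rewrite -[leRHS]exprM [(n * 2)%N]mulnC exprM; apply: lerXn2r; rewrite ?nnegrE ?sqr_ge0 //.
by have := sqr_ge0 (#|U|%:R / M%:R : R); rewrite natrM; lra.
Qed.

Local Open Scope classical_set_scope.

(** * From counting to probability *)

Lemma uniform_prob_itv (R : realType) (x y : R) : 0 <= x -> x <= y -> y <= 1 ->
  uniform_prob (@ltr01 R) `[x, y[%classic = (y - x)%:E.
Proof.
move=> x0 xy y1; rewrite /uniform_prob.
rewrite (eq_integral (cst 1%E)); last first.
  move=> z; rewrite inE /= in_itv /= => /andP[xz zy].
  rewrite /uniform_pdf subr0 invr1.
  by rewrite (le_trans x0 xz) (le_trans (ltW zy) y1).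
rewrite integral_cst //= mul1e lebesgue_measure_itv /= lte_fin.
case: ltP => [//|yx].
by congr (_%:E); lra.
Qed.

Section Transfer.
Variables (d : measure_display) (T : measurableType d) (R : realType).
Variables (P : probability T R) (n M : nat) (X : 'I_n -> {RV P >-> R}).
Hypotheses (indep : mutually_independent X) (unif : forall i, uniform01 (X i)).
Hypothesis M0 : (0 < M)%N.

Let cell (k : nat) : set R := `[k%:R / M%:R, k.+1%:R / M%:R[%classic.

Lemma prob_cells (f : {ffun 'I_n -> 'I_M}) :
  P (\bigcap_(i in [set` [set: 'I_n]%SET]) (X i @^-1` cell (f i))) =
  ((M%:R ^+ n)^-1)%:E.
Proof.
rewrite (@indep _ (fun i => cell (f i))); last by move=> i; exact: measurable_itv.
have M0' : M%:R != 0 :> R by rewrite pnatr_eq0 -lt0n.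
rewrite (eq_bigr (fun=> (M%:R^-1)%:E)) => [|i _].
  by rewrite prodEFin prodr_const cardsT card_ord exprVn.
have := @unif i (cell (f i)) (measurable_itv _); rewrite /distribution /pushforward => ->.
rewrite uniform_prob_itv.
- by rewrite -natr1; congr (_%:E); field.
- by rewrite divr_ge0.
- by rewrite ler_pM2r ?invr_gt0 ?ltr0n // ler_nat.
- by rewrite ler_pdivrMr ?ltr0n // mul1r ler_nat.
Qed.

(** The disjoint events [A f] have probability [M^-n] each. Labels outside [[0, 1)], such as 1,
    belong to no cell, which a lower bound tolerates. *)
Lemma prob_ge_count (Q : {set {ffun 'I_n -> 'I_M}}) (S : set T) :
  measurable S ->
  (forall (w : T) (f : {ffun 'I_n -> 'I_M}), f \in Q ->
    (forall i, (f i)%:R <= M%:R * X i w < (f i)%:R + 1) -> S w) ->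
  ((#|Q|%:R / M%:R ^+ n)%:E <= P S)%E.
Proof.
move=> mS QS.
pose A (f : {ffun 'I_n -> 'I_M}) : set T :=
  \bigcap_(i in [set` [set: 'I_n]%SET]) (X i @^-1` cell (f i)).
have mA f : measurable (A f).
  apply: fin_bigcap_measurable => [|i _]; first exact: finite_finset.
  by rewrite -[X in measurable X]setTI; apply: measurable_funP => //; exact: measurable_itv.
have Af f w : A f w -> forall i, (f i)%:R <= M%:R * X i w < (f i)%:R + 1.
  move=> Afw i; have := Afw i; rewrite /= inE => /(_ isT); rewrite /cell /= in_itv /=.
  rewrite ler_pdivrMr ?ltr0n // ltr_pdivlMr ?ltr0n // -natr1.
  by rewrite [X i w * _]mulrC.
have tA : trivIset [set` Q] A.
  move=> f g _ _ [w [/Af fw /Af gw]]; apply/ffunP => i; apply: val_inj.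
  have /andP[f1 f2] := fw i; have /andP[g1 g2] := gw i.
  apply/eqP; rewrite /= eqn_leq -[(f i <= _)%N]ltnS -[(g i <= _)%N]ltnS -!(ltr_nat R) -!natr1.
  by rewrite (le_lt_trans f1 g2) (le_lt_trans g1 f2).
have -> : (#|Q|%:R / M%:R ^+ n)%:E = P (\bigcup_(f in [set` Q]) A f).
  rewrite measure_fin_bigcup //.
  rewrite (eq_fsbigr (fun=> ((M%:R ^+ n)^-1)%:E)); last by move=> f _; exact: prob_cells.
  rewrite (_ : [set` Q] = [set` enum Q]); last first.
    by apply/seteqP; split => f /=; rewrite mem_enum.
  rewrite -fsbig_seq ?enum_uniq // big_enum /= sumEFin sumr_const.
  by rewrite -[X in _ = X%:E]mulr_natl.
apply: le_measure; rewrite ?inE //.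
  by apply: fin_bigcup_measurable => // ; exact: finite_finset.
by move=> w [f /= Qf /Af]; exact: QS.
Qed.

End Transfer.

(** There are finitely many edge relations; the event is the union, over the connected ones, of the
    events that the graph is exactly that one. *)
Lemma measurable_connected (d : measure_display) (T : measurableType d)
    (R : realType) (P : probability T R) (n : nat) (X : 'I_n -> {RV P >-> R})
    (r1 r2 : R) :
  measurable [set w | graph_connected (VRG r1 r2 (fun i => X i w))].
Proof.
have mE i j : measurable [set w | VRG r1 r2 (fun i => X i w) i j].
  have mX k : measurable_fun setT (X k) by [].
  have md : measurable_fun setT (fun w => dL (X i w) (X j w)).
    have mn : measurable_fun setT (fun w => `|X i w - X j w|).
      by apply: measurableT_comp => //; exact: measurable_funB.
    by apply: measurable_minr => //; exact: measurable_funB.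
  case: (eqVneq i j) => [->|ij].
    rewrite (_ : [set w | _] = set0); first exact: measurable0.
    by apply/seteqP; split => w //=; rewrite /VRG eqxx.
  rewrite (_ : [set w | _] = (fun w => dL (X i w) (X j w)) @^-1` `[r1, r2]).
    by rewrite -[X in measurable X]setTI; apply: md => //; exact: measurable_itv.
  by apply/seteqP; split => w /=; rewrite /VRG ij in_itv.
pose graph (w : T) : {ffun 'I_n * 'I_n -> bool} :=
  [ffun ij => VRG r1 r2 (fun i => X i w) ij.1 ij.2].
pose A (g : {ffun 'I_n * 'I_n -> bool}) : set T :=
  \bigcap_(ij in [set: 'I_n * 'I_n]) [set w | VRG r1 r2 (fun i => X i w) ij.1 ij.2 = g ij].
have mA g : measurable (A g).
  apply: fin_bigcap_measurable => [|ij _]; first exact: finite_finset.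
  case: (g ij); first exact: mE.
  rewrite (_ : [set w | _] = ~` [set w | VRG r1 r2 (fun i => X i w) ij.1 ij.2]).
    exact: measurableC.
  by apply/seteqP; split => w /=; [move=> ->|move/negP/negbTE].
rewrite (_ : [set w | _] =
    \bigcup_(g in [set g : {ffun 'I_n * 'I_n -> bool} |
       graph_connected (fun i j => g (i, j))]) A g).
  by apply: fin_bigcup_measurable.
apply/seteqP; split => w /=.
  move=> c; exists (graph w); last by move=> [i j] _ /=; rewrite ffunE.
  move=> u v /=; have := c u v; congr is_true; apply: eq_connect => x y.
  by rewrite ffunE.
move=> [g cg Ag] u v; have := cg u v; congr is_true; apply: eq_connect => x y.
by have /= := Ag (x, y) I.
Qed.

(** * From cells to the graph *)

(** A displacement in [[0, 1/2]] between lifts leaves only [q = 0], no passage through 0, and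
    [q = 1], one passage. *)
Lemma VRG_lift (R : realType) (n : nat) (r1 r2 : R) (x : 'I_n -> R)
    (i j : 'I_n) (q : int) :
  0 <= x i < 1 -> 0 <= x j < 1 -> 0 <= r1 -> r2 <= 2^-1 -> i != j ->
  r1 <= x j - x i + q%:~R <= r2 -> VRG r1 r2 x i j.
Proof.
move=> /andP[i0 i1] /andP[j0 j1] r10 r2h ij /andP[d1 d2].
rewrite /VRG ij /=.
have q0 : 0 <= q.
  rewrite leNgt; apply/negP => q0.
  have : (q%:~R : R) <= (-1)%:~R by rewrite ler_int; lia.
  by rewrite mulrN1z; lra.
have q1 : q <= 1.
  rewrite leNgt; apply/negP => q1.
  have : (2%:~R : R) <= q%:~R by rewrite ler_int; lia.
  by rewrite -[2%:~R]/(2 : R); lra.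
have [e|e] : q = 0 \/ q = 1 by lia.
  rewrite e mulr0z in d1 d2.
  by rewrite /dL distrC ger0_norm ?min_l; lra.
rewrite e -[1%:~R]/(1 : R) in d1 d2.
by rewrite /dL ger0_norm ?min_r; lra.
Qed.

Lemma hits_windows_occupied (n M N m : nat) (f : {ffun 'I_n -> 'I_M}) (s : int)
    (A : seq int) :
  (0 < M)%N -> hits_windows N m f -> uniq A -> size A = m ->
  (forall j, j \in A -> s <= j < s + N%:Z) ->
  exists i (q : int), (f i)%:Z + q * M%:Z \in A.
Proof.
move=> M0 hits uA szA rA.
pose B := [set a : 'I_N | s + (a : nat)%:Z \in A]%SET.
have cB : #|B| == m.
  rewrite -szA cardE -(size_map (fun a : 'I_N => s + (a : nat)%:Z)).
  apply/eqP/perm_size/uniq_perm => //.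
    rewrite map_inj_uniq ?enum_uniq // => a a' e; apply: val_inj => /=; lia.
  move=> z; apply/mapP/idP => [[a]|zA].
    by rewrite mem_enum inE => ? ->.
  have zN := rA z zA.
  have zs : (absz (z - s)%R < N)%N by lia.
  have e : s + (absz (z - s)%R)%:Z = z by lia.
  by exists (Ordinal zs) => /=; rewrite ?mem_enum ?inE /= e.
have sM : (absz (s %% M)%Z < M)%N.
  have := @ltz_mod s M; have := @modz_ge0 s M; lia.
have /forallP /(_ B) /implyP /(_ cB) /existsP[i /existsP[a /andP[aB /eqP fi]]] :=
  forallP hits (Ordinal sM).
(* The number of turns adds those of the start [s] and the one made if the window wraps around. *)
exists i, ((s %/ M)%Z + ((absz (s %% M)%Z + a) %/ M)%N%:Z).
move: aB; rewrite inE; congr (_ \in A).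
have e1 := divz_eq s M; have e2 := divn_eq (absz (s %% M)%Z + a) M.
rewrite fi /=.
have := @modz_ge0 s M; lia.
Qed.

(** [line_related] is applied to the lifts [(i, q)], in cell [f i + q M]. Cells differing by [be] to
    [al] hold labels between [be - 1] and [al + 1] cell lengths apart, hence the margins of 1 in the
    hypotheses. *)
Lemma hits_windows_connected (R : realType) (n M be al m : nat) (r1 r2 : R)
    (x : 'I_n -> R) (f : {ffun 'I_n -> 'I_M}) :
  (0 < be < al)%N -> (0 < m <= al)%N -> (m <= 2 * (al.+1 - be))%N ->
  0 <= r1 -> r2 <= 2^-1 -> r1 * M%:R <= be%:R - 1 -> al%:R + 1 <= r2 * M%:R ->
  (forall i, (f i)%:R <= M%:R * x i < (f i)%:R + 1) ->
  hits_windows (4 * (m * al) + m.+1) m f -> graph_connected (VRG r1 r2 x).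
Proof.
move=> /andP[be0 beal] /andP[m0 mal] mw r10 r2h hbe hal fx hits u v.
have M0 : (0 < M)%N by case: (f u) => k; case: (M).
have M0R : 0 < M%:R :> R by rewrite ltr0n.
have x01 i : 0 <= x i < 1.
  have /andP[h1 h2] := fx i; apply/andP; split.
    by rewrite -(pmulr_rge0 _ M0R); apply: le_trans h1.
  rewrite -(ltr_pM2l M0R) mulr1; apply: lt_le_trans h2 _.
  by rewrite natr1 ler_nat.
pose c (w : 'I_n * int) := (f w.1)%:Z + w.2 * M%:Z.
pose r (w z : 'I_n * int) : Prop := connect (VRG r1 r2 x) w.1 z.1.
have := @line_related _ c r be al m.
suff H : forall s, few_empty _ c m s (s + (4 * (m * al) + m.+1)%N%:Z).
  move=> /(_ _ _ _ be0 beal m0 mal mw H (u, 0) (v, 0)); apply.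
  - by move=> w z; rewrite /r (sym_connect_sym (@VRG_sym _ _ _ _ _)).
  - by move=> w z t; exact: connect_trans.
  move=> [i k] [j l]; rewrite /c /r /= => h.
  (* Two lifts of one vertex may be this far apart; they are related by the empty path. *)
  case: (eqVneq i j) => [->|ij]; first exact: connect0.
  apply/connect1/(@VRG_lift _ _ _ _ _ _ _ (l - k)) => //.
  have /andP[i1 i2] := fx i; have /andP[j1 j2] := fx j.
  have /andP[] : (be%:Z%:~R <= ((f j)%:Z - (f i)%:Z + (l - k) * M%:Z)%:~R :> R) &&
     (((f j)%:Z - (f i)%:Z + (l - k) * M%:Z)%:~R <= al%:Z%:~R :> R).
    have e : (f j)%:Z + l * M%:Z - ((f i)%:Z + k * M%:Z) =
        (f j)%:Z - (f i)%:Z + (l - k) * M%:Z by ring.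
    by rewrite !ler_int -e.
  rewrite intrD intrM [((f j)%:Z - _)%:~R]intrB -!pmulrn => d1 d2.
  by apply/andP; split; rewrite -(ler_pM2r M0R) [(_ + _) * M%:R]mulrDl mulrBl; lra.
move=> s A uA hA; rewrite ltnNge; apply/negP => mA.
(* [hits_windows] speaks of sets of exactly [m] cells, so [A] is cut down to that size. *)
have [||j /mem_take /hA[//]|i [q /mem_take /hA[_ /negP]]] :=
  @hits_windows_occupied _ _ _ _ f s (take m A) M0 hits.
- exact: take_uniq.
- by rewrite size_takel.
by apply; apply/asboolP; exists (i, q).
Qed.

Lemma dL_le_cases (R : realType) (x y r : R) : dL x y <= r ->
  `|x - y| <= r \/ 1 - `|x - y| <= r.
Proof. by rewrite /dL ge_min => /orP. Qed.

(** The middle cell of the block is occupied and the cells [be] to [al] away from it are empty; with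
    truncated subtraction, [0 < be] makes each disjunct one-sided. Labels at an integer-bounded
    distance in [[be, al]] lie in cells whose difference is in the same range. *)
Lemma isolated_disconnected (R : realType) (n M K be al : nat) (r1 r2 : R)
    (KsM : (K * (al + al).+1 <= M)%N) (x : 'I_n -> R)
    (f : {ffun 'I_n -> 'I_M}) (t : 'I_K) :
  (1 < n)%N -> be%:R <= r1 * M%:R -> r2 * M%:R <= al%:R -> (0 < be)%N ->
  (forall i, (f i)%:R <= M%:R * x i < (f i)%:R + 1) ->
  f \in lone_in_pattern KsM n (inord al)
    [set k : 'I_(al + al).+1 | (be <= k - al <= al) || (be <= al - k <= al)]%N%SET t ->
  ~ graph_connected (VRG r1 r2 x).
Proof.
move=> n1 hbe hal be0 fx /lone_in_patternP[[i fi] empty].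
have M0 : (0 < M)%N by case: (f i) => k; case: (M).
have M0R : 0 < M%:R :> R by rewrite ltr0n.
have x1 j : M%:R * x j < M%:R.
  have /andP[_ h] := fx j; apply: lt_le_trans h _.
  by rewrite natr1 ler_nat.
have x0 j : 0 <= M%:R * x j by have /andP[h _] := fx j; apply: le_trans h.
rewrite inordK in fi; last by lia.
have block : (t * (al + al).+1 + (al + al).+1 <= M)%N.
  by apply: leq_trans KsM; rewrite addnC -mulSn leq_mul2r ltn_ord orbT.
move: (t * (al + al).+1)%N fi empty block => c fi empty block.
have hole j : (c <= f j < c + (al + al).+1)%N ->
    ~~ ((be <= f j - (c + al) <= al) || (be <= c + al - f j <= al))%N.
  move=> /andP[h1 h2]; apply/negP => h3.
  have ks : (f j - c < (al + al).+1)%N by rewrite ltn_subLR.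
  apply: (empty j (Ordinal ks)); last by rewrite /= subnKC.
  by move: h3; rewrite inE /= -subnDA -[(al - _)%N](subnDl c) subnKC.
(* The block stays inside [[0, M)], which leaves [al] cells on both sides and excludes neighbours
   through 0. *)
have fi1 : al%:R <= (f i)%:R :> R by rewrite ler_nat; lia.
have fi2 : (f i)%:R + 1 + al%:R <= M%:R :> R by rewrite natr1 -natrD ler_nat; lia.
have iso j : ~~ VRG r1 r2 x i j.
  apply/negP => /andP[ij /andP[d1 d2]].
  have {}d1 : r1 * M%:R <= `|x i - x j| * M%:R.
    by rewrite ler_pM2r //; apply: le_trans d1 _; rewrite /dL ge_min lexx.
  have /andP[i1 i2] := fx i; have /andP[j1 j2] := fx j.
  have abs : `|x i - x j| * M%:R = `|M%:R * x i - M%:R * x j|.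
    by rewrite -mulrBr normrM (gtr0_norm M0R) mulrC.
  have {d2} d2 : `|x i - x j| * M%:R <= al%:R.
    case: (dL_le_cases d2); rewrite -(ler_pM2r M0R) => h.
      exact: le_trans h hal.
    rewrite mulrBl mul1r abs in h.
    have := x1 j; have := x0 j; case: (lerP (M%:R * x i) (M%:R * x j)) h => *; lra.
  rewrite abs in d1 d2.
  have [le_ji|lt_ij] := leqP (f j) (f i).
    have le1 : (f i <= f j + al)%N.
      rewrite leqNgt; apply/negP; rewrite -addSn -(ler_nat R) natrD -natr1.
      move: d2; rewrite ler_norml => /andP[]; lra.
    have le2 : (f j + be <= f i)%N.
      rewrite leqNgt; apply/negP; rewrite -(ler_nat R) -natr1 natrD => h.
      move: le_ji; rewrite -(ler_nat R).
      case: (lerP (M%:R * x i) (M%:R * x j)) d1 => *; lra.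
    by have := hole j; clear - fi le1 le2; lia.
  have le1 : (f j <= f i + al)%N.
    rewrite leqNgt; apply/negP; rewrite -addSn -(ler_nat R) natrD -natr1.
    move: d2; rewrite ler_norml => /andP[]; lra.
  have le2 : (f i + be <= f j)%N.
    rewrite leqNgt; apply/negP; rewrite -(ler_nat R) -natr1 natrD => h.
    move: lt_ij; rewrite -(ler_nat R) -natr1.
    case: (lerP (M%:R * x i) (M%:R * x j)) d1 => *; lra.
  by have := hole j; clear - fi le1 le2; lia.
move=> conn.
have [j ij] : exists j : 'I_n, j != i.
  case: n n1 i {x f fx empty fi fi1 fi2 iso hole conn x1 x0} => [|[|n]] // _ i.
  case: (eqVneq i ord0) => [->|h]; first by exists ord_max.
  by exists ord0; rewrite eq_sym.
have /connectP[[|k p]] := conn i j; first by move=> _ e; rewrite e eqxx in ij.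
by move=> /= /andP[ik _]; move: (iso k); rewrite ik.
Qed.

(** Each of the two blocks ends with [al] empty cells, a gap too long for an edge; the gaps cut the
    circle into two arcs, both inhabited. *)
Lemma two_gaps_disconnected (R : realType) (n M K al : nat) (r1 r2 : R)
    (KsM : (K * al.+1 <= M)%N) (x : 'I_n -> R)
    (f : {ffun 'I_n -> 'I_M}) (t t' : 'I_K) :
  (t < t')%N -> r2 * M%:R <= al%:R ->
  (forall i, (f i)%:R <= M%:R * x i < (f i)%:R + 1) ->
  f \in lone_in_pattern KsM n ord0 [set k | k != ord0]%SET t ->
  f \in lone_in_pattern KsM n ord0 [set k | k != ord0]%SET t' ->
  ~ graph_connected (VRG r1 r2 x).
Proof.
move=> tt' hal fx /lone_in_patternP[[i fi] e1] /lone_in_patternP[[j fj] e2].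
rewrite !addn0 in fi fj.
have M0 : (0 < M)%N by case: (f i) => k; case: (M).
have M0R : 0 < M%:R :> R by rewrite ltr0n.
have x1 k : M%:R * x k < M%:R.
  have /andP[_ h] := fx k; apply: lt_le_trans h _.
  by rewrite natr1 ler_nat.
have x0 k : 0 <= M%:R * x k by have /andP[h _] := fx k; apply: le_trans h.
have block : (t' * al.+1 + al.+1 <= M)%N.
  by apply: leq_trans KsM; rewrite addnC -mulSn leq_mul2r ltn_ord orbT.
have lt_cc' : (t * al.+1 < t' * al.+1)%N by rewrite ltn_mul2r tt'.
move: (t * al.+1)%N (t' * al.+1)%N fi fj e1 e2 block lt_cc' =>
  c c' fi fj e1 e2 block lt_cc'.
have blockR : (c')%N%:R + 1 + al%:R <= M%:R :> R.
  by rewrite natr1 -natrD ler_nat; lia.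
(* The vertices between the gaps: [j] is among them, and [i], just before the first gap, is not. *)
pose arc k := (c < f k <= c')%N.
have arc1 k : arc k -> (c + al.+1 <= f k)%N.
  move=> /andP[h1 h2]; rewrite leqNgt; apply/negP => h.
  have ks : (f k - c < al.+1)%N by rewrite ltn_subLR // ltnW.
  apply: (e1 k (Ordinal ks)); rewrite ?inE -?val_eqE /= ?subnKC ?(ltnW h1) //.
  by rewrite -lt0n subn_gt0.
have arc2 k : ~~ arc k -> (f k <= c)%N || (c' + al.+1 <= f k)%N.
  rewrite negb_and -leqNgt -ltnNge => /orP[->//|h]; apply/orP; right.
  rewrite leqNgt; apply/negP => h'.
  have ks : (f k - c' < al.+1)%N by rewrite ltn_subLR // ltnW.
  apply: (e2 k (Ordinal ks)); rewrite ?inE -?val_eqE /= ?subnKC ?(ltnW h) //.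
  by rewrite -lt0n subn_gt0.
have cross k l : arc k -> ~~ arc l -> ~~ VRG r1 r2 x k l.
  move=> ak al'; apply/negP => /andP[_ /andP[_ /dL_le_cases h]].
  have {}h : `|M%:R * x k - M%:R * x l| <= al%:R \/
      M%:R - `|M%:R * x k - M%:R * x l| <= al%:R.
    have abs : `|M%:R * x k - M%:R * x l| = `|x k - x l| * M%:R.
      by rewrite -mulrBr normrM (gtr0_norm M0R) mulrC.
    rewrite abs; case: h; rewrite -(ler_pM2r M0R) ?mulrBl ?mul1r => h; [left|right];
      exact: le_trans h hal.
  have /andP[k1 k2] := fx k; have /andP[l1 l2] := fx l.
  have := arc1 k ak; rewrite -(ler_nat R) natrD -[al.+1%:R]natr1 => g1.
  move: (ak) => /andP[_]; rewrite -(ler_nat R) => g2.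
  have c0 : 0 <= c%:R :> R by [].
  have := x1 k; have := x0 k; have := x1 l; have := x0 l.
  case/orP: (arc2 l al'); rewrite -(ler_nat R) ?natrD -?[al.+1%:R]natr1 => g3;
    case: (lerP (M%:R * x k) (M%:R * x l)) h => ? [] *; lra.
move=> conn.
have cl : fingraph.closed (VRG r1 r2 x) arc.
  move=> k l e; rewrite !unfold_in.
  apply/idP/idP => [ak|al']; apply: contraLR e.
    exact: cross.
  by rewrite VRG_sym => h; exact: cross.
have := closed_connect cl (conn i j); rewrite !unfold_in /arc fi fj ltnn /= leqnn.
by rewrite andbT lt_cc'.
Qed.

(** * Asymptotics *)

Lemma near_ln_ge (R : realType) (A : R) : \forall n \near \oo, A <= ln n%:R.
Proof.
near=> n.
have h : expR A <= n%:R by near: n; exact: nbhs_infty_ger.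
have n0 : 0 < n%:R :> R by apply: lt_le_trans h; exact: expR_gt0.
by rewrite -(expRK A) ler_ln // posrE ?expR_gt0.
Unshelve. all: by end_near. Qed.

(** With [z] the square root of [n], [ln n = 2 ln z <= 2 z <= e z^2] once [z >= 2 / e]. *)
Lemma near_ln_le (R : realType) (e : R) : 0 < e ->
  \forall n \near \oo, ln n%:R <= e * n%:R.
Proof.
move=> e0; near=> n.
have h : (2 / e) ^+ 2 <= n%:R by near: n; exact: nbhs_infty_ger.
have n0 : 0 < n%:R :> R by apply: lt_le_trans h; rewrite exprn_gt0 ?divr_gt0.
have sq := sqr_sqrtr (ltW n0); set z := Num.sqrt n%:R in sq.
have z0 : 0 < z by rewrite sqrtr_gt0.
have hz : 2 <= e * z.
  rewrite -ler_pdivrMl // mulrC -(@ler_sqr _ (2 / e)) ?nnegrE ?sq //.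
    by rewrite ltW ?divr_gt0.
  exact: ltW.
rewrite -sq lnXn //; have := ln_sublinear z0; rewrite mulr2n expr2 mulrA.
have : 2 * z <= e * z * z by rewrite ler_pM2r.
lra.
Unshelve. all: by end_near. Qed.

Lemma exprn_le_expR (R : realType) (x : R) n : x <= 1 ->
  (1 - x) ^+ n <= expR (- (n%:R * x)).
Proof.
move=> x1; rewrite -mulrN expRM_natl; apply: lerXn2r; rewrite ?nnegrE ?expR_ge0 //.
  by rewrite subr_ge0.
by have := expR_ge1Dx (- x); lra.
Qed.

(** [1 / (1 - x) = 1 + x / (1 - x)] is at most the exponential of [x / (1 - x)]. *)
Lemma expR_le_exprn (R : realType) (x : R) n : x < 1 ->
  expR (- (n%:R * (x / (1 - x)))) <= (1 - x) ^+ n.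
Proof.
move=> x1; have x1' : 0 < 1 - x by rewrite subr_gt0.
rewrite -mulrN expRM_natl; apply: lerXn2r; rewrite ?nnegrE ?expR_ge0 //.
  exact: ltW.
rewrite expRN -[leRHS]invrK lef_pV2 ?posrE ?invr_gt0 ?expR_gt0 //.
have := expR_ge1Dx (x / (1 - x)).
by have -> : 1 + x / (1 - x) = (1 - x)^-1 by field; rewrite gt_eqF.
Qed.

Definition cells (R : realType) (m n : nat) : nat :=
  Num.truncn (n%:R * m%:R / ln n%:R : R).

Lemma cells_itv (R : realType) (m n : nat) : 0 < ln n%:R :> R ->
  ((cells R m n)%:R * ln n%:R <= n%:R * m%:R :> R) *
  (n%:R * m%:R < ((cells R m n)%:R + 1) * ln n%:R :> R).
Proof.
move=> y0; have : 0 <= n%:R * m%:R / ln n%:R :> R.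
  by rewrite divr_ge0 ?mulr_ge0 // ltW.
move=> /Num.Theory.truncn_itv /andP[]; rewrite -/(cells R m n) => h1 h2.
split; first by rewrite -ler_pdivlMr.
by rewrite natr1 -ltr_pdivrMr.
Qed.

(** The power is at most [exp (- n m / M) <= 1 / n], and [M / n <= m / ln n]. *)
Lemma missed_windows_bound (R : realType) (n M m : nat) :
  (0 < M)%N -> (m <= M)%N -> 0 < ln n%:R :> R ->
  M%:R * ln n%:R <= n%:R * m%:R :> R ->
  M%:R * (1 - m%:R / M%:R) ^+ n <= m%:R / ln n%:R :> R.
Proof.
move=> M0 mM y0 hM.
have M0R : 0 < M%:R :> R by rewrite ltr0n.
have n0 : 0 < n%:R :> R.
  by rewrite ltNge; apply/negP => n0; move: y0; rewrite ln0 ?ltxx.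
have h : (1 - m%:R / M%:R) ^+ n <= n%:R^-1 :> R.
  apply: le_trans (exprn_le_expR _ _) _; first by rewrite ler_pdivrMr // mul1r ler_nat.
  rewrite -[leRHS](_ : expR (- ln n%:R) = _).
    by rewrite ler_expR lerN2 mulrA ler_pdivlMr // mulrC.
  by rewrite expRN lnK // posrE.
apply: le_trans (_ : M%:R * n%:R^-1 <= _); first by rewrite ler_pM2l.
by rewrite ler_pdivlMr // mulrAC ler_pdivrMr // [leRHS]mulrC.
Qed.

(** [K p] grows with [y], and [q / p] tends to 1 because the extra cell is rarely empty. The crude
    bound [exp z >= 1 + z] makes both errors of order [1 / y]. *)
Lemma lone_pattern_bound (R : realType) (n M K m s u : nat) :
  let y : R := ln n%:R in
  let q : R := (1 - u%:R / M%:R) ^+ n in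
  let p : R := q - (1 - u.+1%:R / M%:R) ^+ n in
  (0 < s)%N -> (u < m)%N -> (M < K.+1 * s)%N ->
  M%:R * y <= n%:R * m%:R -> n%:R * m%:R < (M%:R + 1) * y ->
  32 * s%:R * m%:R ^+ 4 <= y -> 2 * m%:R * y <= n%:R ->
  2 * (1 + s%:R) * y <= n%:R ->
  [/\ (2 * m <= M)%N, 0 < p, 2 <= K%:R * p &
   4 * ((K%:R * p)^-1 + (q / p) ^+ 2 - 1) <=
     (64 * s%:R * m%:R ^+ 4 + 32 * m%:R) / y].
Proof.
move=> y q p s0 um MKs M1 M2 y1 y2 y3.
set N : R := n%:R in M1 M2 y2 y3 *; set mR : R := m%:R in M1 M2 y1 y2 *.
set sR : R := s%:R in y1 y3 *.
have sR1 : 1 <= sR by rewrite ler1n.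
have mR1 : 1 <= mR by rewrite ler1n; lia.
have m4 : 1 <= mR ^+ 4 by rewrite exprn_ege1.
have mR0 : 0 < mR by lra.
have sR0 : 0 < sR by lra.
have m40 : 0 < mR ^+ 4 by lra.
have m4m : mR <= mR ^+ 4 by rewrite -[leLHS]expr1 ler_weXn2l.
have sm4 : mR <= sR * mR ^+ 4.
  by apply: le_trans m4m _; rewrite ler_peMl // (le_trans _ m4).
have y32 : 32 * mR <= y by lra.
have y0 : 0 < y by lra.
have N0 : 0 < N.
  have : 0 <= (2 * mR - 2) * y by rewrite mulr_ge0 //; lra.
  lra.
have Ny : N = expR y by rewrite lnK.
set MR : R := M%:R in M1 M2 *.
have M2m : 2 * mR * mR < MR + 1.
  rewrite -(ltr_pM2r y0); apply: le_lt_trans M2.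
  by rewrite mulrAC ler_wpM2r //; lra.
have MmN : (2 * m <= M)%N.
  move: M2m; rewrite /mR /MR natr1 -!natrM ltr_nat ltnS; apply: leq_trans.
  by rewrite leq_pmulr //; exact: leq_ltn_trans um.
have M2m' : 2 * mR <= MR by rewrite /mR /MR -natrM ler_nat.
set uR : R := u%:R.
have u0 : 0 <= uR by [].
have um1 : uR + 1 <= mR by rewrite /uR natr1 ler_nat.
have MR0 : 0 < MR by lra.
have Mu : 0 < MR - uR by lra.
(* As u + 1 <= m, q >= n^(-(1 - 1/m^2)), so that K p is at least linear in y. *)
have q_ge : expR (- ((1 - mR ^- 2) * y)) <= q.
  apply: le_trans (expR_le_exprn _ _); last by rewrite ltr_pdivrMr // -/uR -/MR; lra.
  rewrite ler_expR lerN2 -/uR -/MR -/N.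
  have -> : uR / MR / (1 - uR / MR) = uR / (MR - uR).
    by field; rewrite !gt_eqF.
  rewrite mulrA ler_pdivrMr // -mulrA.
  (* [M2] gives [(M - u) y >= m (N - y)]. Moreover [(1 - m^-2) m = (m - 1) (1 + 1/m)], and
     [(1 + 1/m) (N - y) >= N] as [(m + 1) y <= N]. *)
  apply: le_trans (_ : (1 - mR ^- 2) * (mR * (N - y)) <= _); last first.
    have : (uR + 1) * y <= mR * y by rewrite ler_pM2r.
    move=> ?; apply: ler_wpM2l; last by lra.
    by rewrite subr_ge0 invf_le1 ?exprn_gt0 ?exprn_ege1 //; lra.
  have -> : (1 - mR ^- 2) * (mR * (N - y)) = (mR - 1) * ((1 + mR^-1) * (N - y)).
    by field; rewrite gt_eqF.
  apply: le_trans (_ : (mR - 1) * N <= _).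
    by rewrite mulrC ler_wpM2r //; lra.
  apply: ler_wpM2l; first by lra.
  rewrite -(@ler_pM2l _ mR); last by lra.
  have -> : mR * ((1 + mR^-1) * (N - y)) = (mR + 1) * (N - y).
    by field; rewrite gt_eqF.
  have : (mR + 1) * y <= 2 * mR * y by rewrite ler_pM2r //; lra.
  lra.
(* [N q >= exp (2 z) >= z^2] with [z = y / (2 m^2)]. *)
have Nq : y ^+ 2 / (4 * mR ^+ 4) <= N * q.
  apply: le_trans (_ : expR (y / mR ^+ 2) <= _); last first.
    apply: le_trans (_ : N * expR (- ((1 - mR ^- 2) * y)) <= _); last first.
      by rewrite ler_pM2l.
    rewrite Ny -expRD ler_expR; lra.
  have -> : y / mR ^+ 2 = 2%:R * (y / (2 * mR ^+ 2)).
    by field; rewrite gt_eqF.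
  rewrite expRM_natl.
  have -> : y ^+ 2 / (4 * mR ^+ 4) = (y / (2 * mR ^+ 2)) ^+ 2.
    by field; rewrite gt_eqF.
  have z0 : 0 <= y / (2 * mR ^+ 2) by rewrite divr_ge0 ?mulr_ge0 ?exprn_ge0 // ltW.
  apply: lerXn2r; rewrite ?nnegrE ?expR_ge0 //.
  by have := expR_ge1Dx (y / (2 * mR ^+ 2)); lra.
have q0 : 0 < q by apply: lt_le_trans q_ge; exact: expR_gt0.
set KR : R := K%:R.
(* From [(K + 1) s >= M + 1], so [K s y + s y >= N]; the term [s y] is at most [N / 2]. *)
have KN : N <= 2 * (sR * y) * KR.
  have h1 : MR + 1 <= KR * sR + sR.
    by rewrite /MR /KR /sR natr1 -natrM -natrD ler_nat addnC -mulSn.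
  have h2 : MR * y + y <= KR * sR * y + sR * y.
    by rewrite -mulrDl -[X in _ + X <= _]mul1r -mulrDl ler_pM2r.
  have h3 : N <= N * mR by rewrite ler_peMr // ltW.
  lra.
have Kq : y / (8 * sR * mR ^+ 4) <= KR * q.
  have h : N * q <= 2 * (sR * y) * KR * q by rewrite ler_pM2r.
  have sy : 0 < 2 * (sR * y) by rewrite !mulr_gt0.
  rewrite -(ler_pM2l sy) [leRHS]mulrA; apply: le_trans h.
  have -> // : 2 * (sR * y) * (y / (8 * sR * mR ^+ 4)) = y ^+ 2 / (4 * mR ^+ 4).
  by field; rewrite !gt_eqF.
(* The probability that one given cell is empty. *)
set dl : R := (1 - MR^-1) ^+ n.
have MR1 : MR^-1 <= 1 by rewrite invf_le1 //; lra.
have dl0 : 0 <= dl by rewrite exprn_ge0 // subr_ge0.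
have dl_le : dl <= mR / y.
  apply: le_trans (exprn_le_expR _ MR1) _.
  apply: le_trans (_ : expR (- (y / mR)) <= _).
    rewrite ler_expR lerN2 -/N ler_pdivlMr // mulrAC ler_pdivrMr; last by lra.
    by rewrite mulrC.
  rewrite expRN -[leRHS]invf_div lef_pV2 ?posrE ?expR_gt0 ?divr_gt0 //.
  by have := expR_ge1Dx (y / mR); lra.
have dl32 : dl <= 1 / 32.
  apply: le_trans dl_le _; rewrite ler_pdivrMr //; lra.
have p_ge : q * (1 - dl) <= p.
  rewrite mulrBr mulr1 lerD2l lerN2 /q /dl -exprMn; apply: lerXn2r; rewrite ?nnegrE.
  - by rewrite subr_ge0 ler_pdivrMr // mul1r -natr1 -/uR; lra.
  - by rewrite mulr_ge0 ?subr_ge0 // ler_pdivrMr // mul1r -/uR; lra.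
  rewrite -natr1 -/uR -/MR.
  have -> : (1 - uR / MR) * (1 - MR^-1) = 1 - (uR + 1) / MR + uR / MR / MR.
    by field; rewrite gt_eqF.
  by rewrite lerDl !divr_ge0 // ltW.
have p_ge2 : q / 2 <= p.
  apply: le_trans p_ge; rewrite ler_pM2l //; lra.
have p0 : 0 < p by lra.
have Kp : y / (16 * sR * mR ^+ 4) <= KR * p.
  apply: le_trans (_ : KR * (q / 2) <= _); last by rewrite ler_wpM2l.
  have -> : y / (16 * sR * mR ^+ 4) = y / (8 * sR * mR ^+ 4) / 2.
    by field; rewrite !gt_eqF.
  by rewrite mulrA ler_pM2r.
have sm0 : 0 < 16 * sR * mR ^+ 4 by rewrite !mulr_gt0.
split => //.
  by apply: le_trans Kp; rewrite ler_pdivlMr //; lra.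
have inv_le : (KR * p)^-1 <= 16 * sR * mR ^+ 4 / y.
  rewrite -[leRHS]invf_div lef_pV2 ?posrE ?divr_gt0 //.
  by apply: lt_le_trans Kp; rewrite divr_gt0.
have dl1 : 0 < 1 - dl by lra.
have qp1 : q / p <= (1 - dl)^-1.
  by rewrite ler_pdivrMr // ler_pdivlMl // mulrC.
have qp : (q / p) ^+ 2 <= 1 + 8 * dl.
  apply: le_trans (_ : ((1 - dl)^-1) ^+ 2 <= _).
    by rewrite ler_sqr ?nnegrE ?divr_ge0 ?invr_ge0 // ltW.
  rewrite exprVn -div1r ler_pdivrMr ?exprn_gt0 //.
  have -> : (1 + 8 * dl) * (1 - dl) ^+ 2 = 1 + dl * (6 - 15 * dl + 8 * dl ^+ 2) by ring.
  rewrite lerDl mulr_ge0 //; have := sqr_ge0 dl; clear - dl32; lra.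
have -> : (64 * sR * mR ^+ 4 + 32 * mR) / y =
    4 * (16 * sR * mR ^+ 4 / y + 8 * (mR / y)) by field; rewrite gt_eqF.
lra.
Qed.

(** * From bounds for large [n] to limits *)

Lemma cvg_prob_to1 (R : realType) (d : nat -> measure_display)
    (T : forall n, measurableType (d n)) (P : forall n, probability (T n) R)
    (S : forall n, set (T n)) : (forall n, measurable (S n)) ->
  (forall e : R, 0 < e -> \forall n \near \oo, ((1 - e)%:E <= P n (S n))%E) ->
  P n (S n) @[n --> \oo] --> 1%:E.
Proof.
move=> mS H.
have fin n : P n (S n) \is a fin_num by exact: fin_num_measure.
apply/fine_cvgP; split; first by near=> n.
apply/cvgrPdist_le => e e0; near=> n.
have h : ((1 - e)%:E <= P n (S n))%E by near: n; exact: H.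
have h1 : (P n (S n) <= 1)%E by exact: probability_le1.
move: h h1; rewrite /= -(fineK (fin n)) !lee_fin => h h1.
by rewrite ger0_norm; lra.
Unshelve. all: by end_near. Qed.

Lemma prob_ge_compl (d : measure_display) (T : measurableType d) (R : realType)
    (P : probability T R) (n M : nat) (X : 'I_n -> {RV P >-> R})
    (Bad : {set {ffun 'I_n -> 'I_M}}) (S : set T) (e : R) :
  mutually_independent X -> (forall i, uniform01 (X i)) -> (0 < M)%N ->
  measurable S -> #|Bad|%:R <= e * M%:R ^+ n ->
  (forall (w : T) (f : {ffun 'I_n -> 'I_M}), f \notin Bad ->
    (forall i, (f i)%:R <= M%:R * X i w < (f i)%:R + 1) -> S w) ->
  ((1 - e)%:E <= P S)%E.
Proof.
move=> indep unif M0 mS cB BS.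
have Mn0 : 0 < M%:R ^+ n :> R by rewrite exprn_gt0 // ltr0n.
apply: le_trans (@prob_ge_count _ _ _ _ _ _ _ indep unif M0 (~: Bad)%SET _ mS _); last first.
  by move=> w f; rewrite inE; exact: BS.
rewrite lee_fin ler_pdivlMr // mulrBl mul1r.
have := cardsC Bad; rewrite card_ffun !card_ord => /(congr1 (fun k => k%:R : R)).
by rewrite natrD natrX; lra.
Qed.

Lemma radius_cells_le (R : realType) (c : R) (m n : nat) : 0 <= c ->
  0 < ln n%:R :> R -> (0 < n)%N ->
  c * ln n%:R / n%:R * (cells R m n)%:R <= c * m%:R.
Proof.
move=> c0 y0 n0; have [h _] := cells_itv m y0.
rewrite -!mulrA ler_wpM2l // mulrCA ler_pdivrMl ?ltr0n //.
by rewrite mulrC.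
Qed.

(** Truncation in [cells] loses less than one cell, which costs at most the radius
    [c ln n / n <= 1]. *)
Lemma radius_cells_ge (R : realType) (c : R) (m n : nat) : 0 <= c ->
  0 < ln n%:R :> R -> (0 < n)%N -> c * ln n%:R <= n%:R ->
  c * m%:R - 1 <= c * ln n%:R / n%:R * (cells R m n)%:R.
Proof.
move=> c0 y0 n0 cy; have [_ h] := cells_itv m y0.
rewrite mulrAC ler_pdivlMr ?ltr0n //.
have := ler_wpM2l c0 (ltW h); lra.
Qed.

(** With as many blocks as fit, the second moment bound is [C / ln n], eventually below [e]. *)
Lemma near_lone_pattern (R : realType) (m s : nat) (o : 'I_s) (U : {set 'I_s})
    (e : R) : o \notin U -> (#|U| < m)%N -> 0 < e ->
  \forall n \near \oo, (0 < cells R m n)%N /\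
    #|[set f | (#|[set t | f \in lone_in_pattern
         (leq_divM (cells R m n) s) n o U t]%SET| <= 1)%N]%SET|%:R <=
    e * (cells R m n)%:R ^+ n.
Proof.
move=> oU um e0; have s0 : (0 < s)%N by apply: leq_ltn_trans (ltn_ord o).
set C : R := 64 * s%:R * m%:R ^+ 4 + 32 * m%:R.
near=> n.
have y1 : 1 <= ln n%:R :> R by near: n; exact: near_ln_ge.
have y2 : 32 * s%:R * m%:R ^+ 4 <= ln n%:R :> R by near: n; exact: near_ln_ge.
have y3 : C / e <= ln n%:R :> R by near: n; exact: near_ln_ge.
have n1 : ln n%:R <= (2 * m%:R)^-1 * n%:R :> R.
  near: n; apply: near_ln_le; rewrite invr_gt0 mulr_gt0 // ltr0n.
  exact: leq_ltn_trans um.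
have n2 : ln n%:R <= (2 * (1 + s%:R))^-1 * n%:R :> R.
  by near: n; apply: near_ln_le; rewrite invr_gt0 mulr_gt0 // ltr_wpDr.
have y0 : 0 < ln n%:R :> R by lra.
have [M1 M2] := cells_itv m y0.
have m0 : 0 < 2 * m%:R :> R by rewrite mulr_gt0 // ltr0n (leq_ltn_trans _ um).
have [||M2m p0 Kp2 bound] := lone_pattern_bound s0 um (ltn_ceil (cells R m n) s0) M1 M2 y2.
- by rewrite -ler_pdivlMl.
- by rewrite -ler_pdivlMl // mulr_gt0 // ltr_wpDr.
have mM : (m <= cells R m n)%N by apply: leq_trans M2m; rewrite leq_pmull.
have UM := leq_trans um mM.
have M0 := leq_ltn_trans (leq0n _) UM.
have U2M : (2 * #|U| <= cells R m n)%N.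
  by apply: leq_trans M2m; rewrite leq_mul2l ltnW.
split=> //.
apply: le_trans (few_lone_in_pattern _ oU M0 U2M UM (erefl _) p0 Kp2) _.
rewrite ler_pM2r; last by rewrite exprn_gt0 // ltr0n.
apply: le_trans bound _.
by rewrite ler_pdivrMr // -ler_pdivrMl // mulrC.
Unshelve. all: by end_near. Qed.

Lemma ex_nat_above (R : realType) (A B : R) (k : nat) :
  exists m : nat, [/\ (k <= m)%N, A <= m%:R & B <= m%:R].
Proof.
exists (k + Num.truncn A + Num.truncn B).+1; split.
- by rewrite leqW // -addnA leq_addr.
- apply: le_trans (ltW (Num.Theory.truncnS_gt A)) _.
  by rewrite ler_nat ltnS addnAC leq_addl.
- apply: le_trans (ltW (Num.Theory.truncnS_gt B)) _.
  by rewrite ler_nat ltnS leq_addl.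
Qed.

(** * The connectivity thresholds *)

Section Main.
Variables (R : realType) (a b : R).
Variables (d : nat -> measure_display) (T : forall n : nat, measurableType (d n)).
Variables (P : forall n : nat, probability (T n) R).
Variables (X : forall n : nat, 'I_n -> {RV (P n) >-> R}).
Hypotheses (b_ge0 : 0 <= b) (le_ba : b <= a).
Hypothesis X_indep : forall n : nat, mutually_independent (@X n).
Hypothesis X_unif : forall (n : nat) (i : 'I_n), uniform01 (@X n i).

Let G (n : nat) (w : T n) : rel 'I_n :=
  VRG (b * ln n%:R / n%:R) (a * ln n%:R / n%:R) (fun i => @X n i w).

Let measurable_disconnected n : measurable [set w : T n | ~ graph_connected (G w)].
Proof.
rewrite (_ : [set w | _] = ~` [set w : T n | graph_connected (G w)]) //.
by apply: measurableC; exact: measurable_connected.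
Qed.

Lemma connected_whp : 1 < a -> 2^-1 < a - b ->
  P n [set w : T n | graph_connected (G w)] @[n --> \oo] --> 1%:E.
Proof.
move=> a1 ab; apply: cvg_prob_to1 => [n|e e0]; first exact: measurable_connected.
have a0 : 0 <= a by exact: le_trans le_ba.
(* These bounds say [a m >= m + 3] and [2 (a - b) m >= m + 8]; the constants absorb all rounding
   losses. *)
have [m [m10 hm1 hm2]] := ex_nat_above (3 / (a - 1)) (8 / (2 * (a - b) - 1)) 10.
rewrite ler_pdivrMr in hm1; last by lra.
rewrite ler_pdivrMr in hm2; last by lra.
have m10R : 10 <= m%:R :> R by rewrite (ler_nat R 10).
have am0 : 0 <= a * m%:R by rewrite mulr_ge0.
have bm0 : 0 <= b * m%:R by rewrite mulr_ge0.
have /andP[ta1 ta2] := Num.Theory.truncn_itv am0.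
have /andP[tb1 tb2] := Num.Theory.truncn_itv bm0.
set ta := Num.truncn (a * m%:R) in ta1 ta2.
set tb := Num.truncn (b * m%:R) in tb1 tb2.
rewrite -natr1 in ta2; rewrite -natr1 in tb2.
have h1 : (m + 2 <= ta)%N.
  by rewrite -ltnS -(ltr_nat R) natrD -natr1; lra.
have h2 : (m + 6 + 2 * tb <= 2 * ta)%N.
  by rewrite -ltnS -(ltr_nat R) -[ltRHS]natr1 2!natrD 2!natrM; lra.
(* [al] gives up one cell for the position of labels within cells and one for the truncation in
   [cells]; [be] is [b m] rounded up past an integer, plus one cell for positions. *)
pose al := (ta - 2)%N; pose be := tb.+2.
have alE : al%:R = ta%:R - 2 :> R by rewrite natrB // (leq_trans _ h1) // leq_addl.
have [be_al m_al m_width] :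
    [/\ 0 < be < al, 0 < m <= al & m <= 2 * (al.+1 - be)]%N.
  by rewrite /be /al; move: (ta) (tb) h1 h2 m10; clear; split; lia.
have al_le : al%:R + 1 <= a * m%:R - 1 by rewrite alE; lra.
have be_ge : b * m%:R <= be%:R - 1 by rewrite /be -!natr1; lra.
set N := (4 * (m * al) + m.+1)%N.
near=> n.
have y1 : 1 <= ln n%:R :> R by near: n; exact: near_ln_ge.
have y2 : 2 ^+ N * m%:R / e <= ln n%:R :> R by near: n; exact: near_ln_ge.
have n2 : ln n%:R <= (2 * a)^-1 * n%:R :> R.
  by near: n; apply: near_ln_le; rewrite invr_gt0; lra.
have n3 : ln n%:R <= (N%:R + 1)^-1 * n%:R :> R.
  by near: n; apply: near_ln_le; rewrite invr_gt0 ltr_wpDl.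
have n0 : (0 < n)%N by near: n; exact: nbhs_infty_ge.
have y0 : 0 < ln n%:R :> R by exact: lt_le_trans y1.
have a20 : 0 < 2 * a by rewrite mulr_gt0 // (lt_trans _ a1).
rewrite -ler_pdivrMl ?invr_gt0 // invrK in n2.
rewrite -ler_pdivrMl ?invr_gt0 ?ltr_wpDl // invrK in n3.
have [M1 M2] := cells_itv m y0.
have NM : (N <= cells R m n)%N.
  rewrite -(ler_nat R) -(lerD2r 1) -(ler_pM2r y0).
  apply: le_trans n3 (le_trans _ (ltW M2)).
  by rewrite ler_peMr //; lra.
have mN : (m < N)%N by rewrite /N addnS ltnS leq_addl.
have M0 : (0 < cells R m n)%N by apply: leq_trans NM; apply: leq_ltn_trans mN.
apply: (prob_ge_compl (X_indep (n := n)) (@X_unif n) M0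
  (Bad := [set f : {ffun 'I_n -> 'I_(cells R m n)} | ~~ hits_windows N m f]%SET)).
- exact: measurable_connected.
- apply: le_trans (_ : ((cells R m n * 2 ^ N * (cells R m n - m) ^ n)%N%:R <= _)).
    by rewrite ler_nat card_not_hits_windows.
  have -> : (cells R m n * 2 ^ N * (cells R m n - m) ^ n)%N%:R =
      2 ^+ N * ((cells R m n)%:R * (1 - m%:R / (cells R m n)%:R) ^+ n) *
      (cells R m n)%:R ^+ n :> R.
    rewrite !natrM !natrX natrB; last exact: leq_trans (ltnW mN) NM.
    rewrite [2 ^+ N * _]mulrA -[RHS]mulrA -exprMn mulrBl mul1r divfK.
      by rewrite [2 ^+ N * _]mulrC.
    by rewrite pnatr_eq0 -lt0n.
  rewrite ler_pM2r; last by rewrite exprn_gt0 // ltr0n.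
  have h := @missed_windows_bound R n (cells R m n) m M0 (leq_trans (ltnW mN) NM) y0 M1.
  apply: le_trans (ler_wpM2l (exprn_ge0 N (ler0n R 2)) h) _.
  by rewrite mulrA ler_pdivrMr // -ler_pdivrMl // mulrC.
move=> w f; rewrite inE negbK => hits fx.
apply: (hits_windows_connected _ _ _ _ _ _ _ fx hits).
- exact: be_al.
- exact: m_al.
- exact: m_width.
- by rewrite divr_ge0 ?mulr_ge0 // ltW.
- by rewrite ler_pdivrMr ?ltr0n // -ler_pdivrMl ?invr_gt0 // invrK mulrA.
- apply: le_trans (radius_cells_le m b_ge0 y0 n0) _.
  exact: be_ge.
have an : a * ln n%:R <= n%:R.
  by apply: le_trans n2; rewrite -mulrA ler_peMl ?mulr_ge0 ?(ltW y0) // ler1n.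
apply: le_trans (radius_cells_ge m a0 y0 n0 an).
exact: al_le.
Unshelve. all: by end_near. Qed.

Lemma disconnected_whp_gaps : a < 1 ->
  P n [set w : T n | ~ graph_connected (G w)] @[n --> \oo] --> 1%:E.
Proof.
move=> a1; apply: cvg_prob_to1 => // e e0.
have a0 : 0 <= a by exact: le_trans le_ba.
(* [(1 - a) m >= 2] leaves room for a gap of [al > a m] cells with [al < m]. *)
have [m [_ hm _]] := ex_nat_above (2 / (1 - a)) 0 0.
rewrite ler_pdivrMr in hm; last by lra.
have am0 : 0 <= a * m%:R by rewrite mulr_ge0.
have /andP[ta1 ta2] := Num.Theory.truncn_itv am0.
set al := (Num.truncn (a * m%:R)).+1 in ta2.
have alm : (al < m)%N by rewrite -(ltr_nat R) -natr1; lra.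
have cU : #|[set k : 'I_al.+1 | k != ord0]%SET| = al.
  by rewrite cardsE cardC1 card_ord.
have oU : ord0 \notin [set k : 'I_al.+1 | k != ord0]%SET by rewrite inE eqxx.
near=> n.
have y1 : 1 <= ln n%:R :> R by near: n; exact: near_ln_ge.
have y0 : 0 < ln n%:R :> R by exact: lt_le_trans y1.
have n0 : (0 < n)%N by near: n; exact: nbhs_infty_ge.
have [M0 few] : (0 < cells R m n)%N /\
    #|[set f | (#|[set t | f \in lone_in_pattern
         (leq_divM (cells R m n) al.+1) n ord0 [set k | k != ord0]%SET t]%SET| <= 1)%N]%SET|%:R <=
    e * (cells R m n)%:R ^+ n.
  by near: n; apply: near_lone_pattern; rewrite ?cU.
apply: (prob_ge_compl (X_indep (n := n)) (@X_unif n) M0 _ few) => //.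
move=> w f; rewrite inE -ltnNge => /card_gt1P[t [t' [tE tE' tt']]] fx.
rewrite inE in tE; rewrite inE in tE'.
have hal : a * ln n%:R / n%:R * (cells R m n)%:R <= al%:R.
  exact: le_trans (radius_cells_le m a0 y0 n0) (ltW ta2).
have [lt|lt|e'] := ltngtP t t'; last by move/val_inj: e' tt' => ->; rewrite eqxx.
  exact: (two_gaps_disconnected lt hal fx tE tE').
exact: (two_gaps_disconnected lt hal fx tE' tE).
Unshelve. all: by end_near. Qed.

Lemma disconnected_whp_isolated : 1 <= a -> a - b < 2^-1 ->
  P n [set w : T n | ~ graph_connected (G w)] @[n --> \oo] --> 1%:E.
Proof.
move=> a1 ab; apply: cvg_prob_to1 => // e e0.
have a0 : 0 <= a by lra.
(* [2 (a - b) m + 8 <= m], so that the [2 (al + 1 - be)] cells of [U] stay fewer than [m] after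
   rounding. *)
have [m [m10 hm _]] := ex_nat_above (8 / (1 - 2 * (a - b))) 0 10.
rewrite ler_pdivrMr in hm; last by lra.
have m10R : 10 <= m%:R :> R by rewrite (ler_nat R 10).
have am0 : 0 <= a * m%:R by rewrite mulr_ge0.
have bm0 : 0 <= b * m%:R by rewrite mulr_ge0.
(* [a >= 1] and [a - b < 1/2] give [b > 1/2], whence [be > 0] below. *)
have bm5 : 5 <= b * m%:R.
  have : 2^-1 * m%:R <= b * m%:R by rewrite ler_pM2r; lra.
  lra.
have /andP[ta1 ta2] := Num.Theory.truncn_itv am0.
have /andP[tb1 tb2] := Num.Theory.truncn_itv bm0.
set al := (Num.truncn (a * m%:R)).+1 in ta2.
set tb := Num.truncn (b * m%:R) in tb1 tb2.
rewrite -natr1 in tb2.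
have alE : al%:R <= a * m%:R + 1 by rewrite -natr1 lerD2r.
have tb4 : (4 < tb)%N by rewrite -(ltr_nat R); lra.
pose be := tb.-1.
have beE : be%:R = tb%:R - 1 :> R by rewrite /be -subn1 natrB // (leq_trans _ tb4).
have be_le : be%:R <= b * m%:R - 1 by rewrite beE; lra.
have be_al : (2 * al + 2 < m + 2 * be)%N.
  by rewrite -(ltr_nat R) 2!natrD 2!natrM beE; lra.
have be_gt0 : (0 < be)%N by rewrite /be -subn1 subn_gt0 (leq_trans _ tb4).
have bea : (be <= al)%N.
  rewrite -(ler_nat R) beE; have : b * m%:R <= a * m%:R by rewrite ler_wpM2r.
  lra.
pose U : {set 'I_(al + al).+1} :=
  [set k : 'I_(al + al).+1 | (be <= k - al <= al) || (be <= al - k <= al)]%N%SET.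
have cU : (#|U| < m)%N.
  (* [U] is contained in two runs of [al + 1 - be] cells, one at each end of the block. *)
  apply: (@leq_ltn_trans (size (iota (al + be) (al.+1 - be) ++ iota 0 (al.+1 - be)))); last first.
    by rewrite size_cat !size_iota; move: be_al bea; generalize be al; clear; lia.
  rewrite cardE -(size_map val); apply: uniq_leq_size.
    by rewrite map_inj_uniq ?enum_uniq //; exact: val_inj.
  move=> z /mapP[k]; rewrite mem_enum inE => hk ->.
  rewrite mem_cat !mem_iota /=; have := ltn_ord k.
  by move: (k : nat) hk bea; generalize be al; clear; lia.
have oU : inord al \notin U.
  rewrite inE inordK; last by rewrite ltnS leq_addl.
  by rewrite subnn orbb negb_and -ltnNge be_gt0.
near=> n.
have y1 : 1 <= ln n%:R :> R by near: n; exact: near_ln_ge.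
have y0 : 0 < ln n%:R :> R by exact: lt_le_trans y1.
have n1 : (1 < n)%N by near: n; exact: nbhs_infty_ge.
have bn : ln n%:R <= (b + 1)^-1 * n%:R :> R.
  by near: n; apply: near_ln_le; rewrite invr_gt0 ltr_wpDl.
have [M0 few] : (0 < cells R m n)%N /\
    #|[set f | (#|[set t | f \in lone_in_pattern
         (leq_divM (cells R m n) (al + al).+1) n (inord al) U t]%SET| <= 1)%N]%SET|%:R <=
    e * (cells R m n)%:R ^+ n.
  by near: n; apply: near_lone_pattern.
apply: (prob_ge_compl (X_indep (n := n)) (@X_unif n) M0 _ few) => //.
move=> w f; rewrite inE -ltnNge => /card_gt1P[t [_ [tE _ _]]] fx.
rewrite inE in tE.
apply: (isolated_disconnected n1 _ _ _ fx tE).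
- have bn' : b * ln n%:R <= n%:R.
    apply: le_trans (_ : (b + 1) * ln n%:R <= _).
      by rewrite mulrDl mul1r lerDl ltW.
    by rewrite -ler_pdivlMl // ltr_wpDl.
  apply: le_trans (radius_cells_ge m b_ge0 y0 (ltnW n1) bn').
  exact: be_le.
- exact: le_trans (radius_cells_le m a0 y0 (ltnW n1)) (ltW ta2).
- exact: be_gt0.
Unshelve. all: by end_near. Qed.

End Main.

Unset Implicit Arguments.
Set Strict Implicit.
Set Printing Implicit Defensive.

Theorem theorem1 (R : realType) (a b : R)
    (d : nat -> measure_display) (T : forall n : nat, measurableType (d n))
    (P : forall n : nat, probability (T n) R)
    (X : forall n : nat, 'I_n -> {RV (P n) >-> R})
    (b_ge0 : 0 <= b) (le_ba : b <= a)
    (X_indep : forall n : nat, mutually_independent (X n))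
    (X_unif : forall (n : nat) (i : 'I_n), uniform01 (X n i)) :
  let G (n : nat) (w : T n) : rel 'I_n :=
    VRG (b * ln n%:R / n%:R) (a * ln n%:R / n%:R) (fun i => X n i w) in
  (1 < a -> 2^-1 < a - b ->
    P n [set w : T n | graph_connected (G n w)] @[n --> \oo] --> 1%:E) /\
  (a < 1 \/ a - b < 2^-1 ->
    P n [set w : T n | ~ graph_connected (G n w)] @[n --> \oo] --> 1%:E).
Proof.
move=> G; split; first exact: connected_whp.
(* Splitting at [a = 1] provides the bound [1 <= a] that the isolated vertex argument requires. *)
move=> h; case: (ltP a 1) => a1; first exact: disconnected_whp_gaps.
case: h => [|ab]; first by rewrite ltNge a1.
exact: disconnected_whp_isolated.
Qed.
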